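(* Let $L=\mathbb{Q}(\sqrt{3})$ with ring of integers $O_L$, and let $$f_7(q):=\sum_{n=0}^{\infty}(-1)^n\frac{q^{n^2+n}(q^2;q^2)_n}{(-q)_{2n+1}}.$$ Then $$q\,f_7(q^3)=-\sum_{\substack{\mathbf{a}\subset O_L\\ \mathcal{N}(\mathbf{a})\equiv 1\pmod 3}}(-1)^{\mathcal{N}(\mathbf{a})}q^{\mathcal{N}(\mathbf{a})},$$ where the sum runs over the nonzero ideals $\mathbf{a}$ of $O_L$ with $\mathcal{N}(\mathbf{a})\equiv 1\pmod 3$.
   Context: Identities are between formal power series in $q$ (equivalently, for $|q|<1$). Notation: $(a;q)_n:=\prod_{j=0}^{n-1}(1-aq^j)$ and $(a)_n:=(a;q)_n$; thus $(-q)_n=\prod_{j=1}^n(1+q^j)$ and $(q^2;q^2)_n=\prod_{j=1}^{n}(1-q^{2j})$. For an ideal $\mathbf{a}$ of $O_L$, $\mathcal{N}(\mathbf{a})=|O_L/\mathbf{a}|$ is its norm. *)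

(* Defs.v *)
From HB Require Import structures.
From mathcomp Require Import all_boot all_order all_algebra all_field.
From mathcomp Require Import finmap all_classical.

Set Implicit Arguments.
Unset Strict Implicit.
Unset Printing Implicit Defensive.

Import GRing.Theory.
Local Open Scope classical_set_scope.
Local Open Scope ring_scope.

(** * Formal power series in one variable *)

Record fps (R : Type) := FPS { fps_coef : nat -> R }.

HB.instance Definition _ (R : Type) := gen_eqMixin (fps R).
HB.instance Definition _ (R : Type) := gen_choiceMixin (fps R).

Lemma fpsP (R : Type) (f g : fps R) : fps_coef f =1 fps_coef g -> f = g.
Proof. by case: f => f; case: g => g /= /funext ->. Qed.

Section FpsRing.
Variable R : comUnitRingType.
Implicit Types (f g h : fps R) (n i : nat).

Definition fps0 : fps R := FPS (fun=> 0).
Definition fps_opp f : fps R := FPS (fun n => - fps_coef f n).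
Definition fps_add f g : fps R := FPS (fun n => fps_coef f n + fps_coef g n).
Definition fps1 : fps R := FPS (fun n => (n == 0%N)%:R).
Definition fps_mul f g : fps R :=
  FPS (fun n => \sum_(i < n.+1) fps_coef f i * fps_coef g (n - i)).

Fact fps_addA : associative fps_add.
Proof. by move=> f g h; apply: fpsP => n /=; rewrite addrA. Qed.
Fact fps_addC : commutative fps_add.
Proof. by move=> f g; apply: fpsP => n /=; rewrite addrC. Qed.
Fact fps_add0 : left_id fps0 fps_add.
Proof. by move=> f; apply: fpsP => n /=; rewrite add0r. Qed.
Fact fps_addN : left_inverse fps0 fps_opp fps_add.
Proof. by move=> f; apply: fpsP => n /=; rewrite addNr. Qed.

HB.instance Definition _ :=
  GRing.isZmodule.Build (fps R) fps_addA fps_addC fps_add0 fps_addN.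

Definition fps_trunc n f : {poly R} := \poly_(i < n.+1) fps_coef f i.

Lemma coef_fps_trunc n f i : (i <= n)%N -> (fps_trunc n f)`_i = fps_coef f i.
Proof. by move=> le_in; rewrite coef_poly ltnS le_in. Qed.

Lemma coef_fps_mul n f g i : (i <= n)%N ->
  fps_coef (fps_mul f g) i = (fps_trunc n f * fps_trunc n g)`_i.
Proof.
move=> le_in; rewrite coefM /=; apply: eq_bigr => j _.
have le_ji : (j <= i)%N by rewrite -ltnS.
by rewrite !coef_fps_trunc ?(leq_trans (leq_subr _ _)) ?(leq_trans le_ji).
Qed.

Fact fps_mulC : commutative fps_mul.
Proof.
by move=> f g; apply: fpsP => n; rewrite !(coef_fps_mul _ _ (leqnn n)) mulrC.
Qed.

Fact fps_mulA : associative fps_mul.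
Proof.
move=> f g h; apply: fpsP => n; rewrite !(coef_fps_mul _ _ (leqnn n)).
transitivity ((fps_trunc n f * fps_trunc n g * fps_trunc n h)`_n).
  rewrite -mulrA !coefM; apply: eq_bigr => j _; congr (_ * _).
  by rewrite coef_fps_trunc ?leq_subr // (@coef_fps_mul n) ?leq_subr.
rewrite !coefM; apply: eq_bigr => j _; congr (_ * _).
by rewrite coef_fps_trunc -1?ltnS // (@coef_fps_mul n) // -ltnS.
Qed.

Fact fps_mul1 : left_id fps1 fps_mul.
Proof.
move=> f; apply: fpsP => n /=; rewrite big_ord_recl /= subn0 mul1r.
by rewrite big1 ?addr0 // => i _; rewrite mul0r.
Qed.

Fact fps_mulDl : left_distributive fps_mul fps_add.
Proof.
move=> f g h; apply: fpsP => n /=; rewrite -big_split /=.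
by apply: eq_bigr => i _; rewrite mulrDl.
Qed.

Fact fps_1neq0 : fps1 != fps0.
Proof.
apply/eqP => /(congr1 (fun f => fps_coef f 0%N)) /= /eqP.
by rewrite oner_eq0.
Qed.

HB.instance Definition _ := GRing.Zmodule_isComNzRing.Build (fps R)
  fps_mulA fps_mulC fps_mul1 fps_mulDl fps_1neq0.

Definition fps_unit : {pred fps R} := fun f => fps_coef f 0%N \is a GRing.unit.

(* The first [n] coefficients of the inverse of [f], from
   [g_n = f_0^-1 (1_{n = 0} - \sum_(i < n) f_(n-i) g_i)]. *)
Fixpoint fps_inv_seq f n : seq R :=
  if n is m.+1 then
    let s := fps_inv_seq f m in
    rcons s ((fps_coef f 0%N)^-1 *
             ((m == 0%N)%:R - \sum_(i < m) fps_coef f (m - i) * s`_i))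
  else [::].

(* As for every [unitRingType], the inverse of a non-unit is itself. *)
Definition fps_inv f : fps R :=
  if fps_unit f then FPS (fun n => (fps_inv_seq f n.+1)`_n) else f.

Lemma size_fps_inv_seq f n : size (fps_inv_seq f n) = n.
Proof. by elim: n => //= n IHn; rewrite size_rcons IHn. Qed.

Lemma nth_fps_inv_seq f n i : (i < n)%N ->
  (fps_inv_seq f n)`_i = (fps_inv_seq f i.+1)`_i.
Proof.
elim: n => // n IHn; rewrite ltnS leq_eqVlt => /orP[/eqP -> //|lt_in].
by rewrite /= nth_rcons size_fps_inv_seq lt_in IHn.
Qed.

Lemma fps_inv_seqE f n :
  (fps_inv_seq f n.+1)`_n = (fps_coef f 0%N)^-1 * ((n == 0%N)%:R -
     \sum_(i < n) fps_coef f (n - i) * (fps_inv_seq f i.+1)`_i).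
Proof.
rewrite [LHS]/= nth_rcons size_fps_inv_seq ltnn eqxx.
by under eq_bigr => i _ do rewrite nth_fps_inv_seq //.
Qed.

Fact fps_mulV : {in fps_unit, left_inverse 1 fps_inv *%R}.
Proof.
move=> f Uf; rewrite /fps_inv; have -> : fps_unit f = true by [].
apply: fpsP => n; rewrite /= big_ord_recr /= subnn.
rewrite -[rcons _ _]/(fps_inv_seq f n.+1) fps_inv_seqE mulrC mulVKr //.
under eq_bigr => i _ do
  rewrite -[rcons _ _]/(fps_inv_seq f i.+1) mulrC.
by rewrite addrC subrK.
Qed.

Fact fps_unitPl : forall f g, g * f = 1 -> f \in fps_unit.
Proof.
move=> f g /(congr1 (fun h => fps_coef h 0%N)) /=.
rewrite big_ord_recl big_ord0 addr0 /= => gf1.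
by apply/unitrPr; exists (fps_coef g 0%N); rewrite mulrC.
Qed.

Fact fps_inv_out : {in [predC fps_unit], fps_inv =1 id}.
Proof.
by move=> f; rewrite inE /= => /negbTE nUf; rewrite /fps_inv [fps_unit f]nUf.
Qed.

HB.instance Definition _ := GRing.ComNzRing_hasMulInverse.Build (fps R)
  fps_mulV fps_unitPl fps_inv_out.

Definition fpsC (c : R) : fps R := FPS (fun n => if n == 0%N then c else 0).
Definition fpsX : fps R := FPS (fun n => (n == 1%N)%:R).

(* Arbitrary sums of families of power series, taken coefficientwise: a family
   is summable when each coefficient vanishes for all but finitely many
   members. *)
Definition fps_summable (I : choiceType) (A : set I) (F : I -> fps R) : Prop :=
  forall n, finite_set [set i | A i /\ fps_coef (F i) n != 0].

Definition fps_sum (I : choiceType) (A : set I) (F : I -> fps R) : fps R :=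
  FPS (fun n => \sum_(i \in A) fps_coef (F i) n).

(* [f(g)]; meaningful when [g] has zero constant term. *)
Definition fps_comp f g : fps R :=
  fps_sum [set: nat] (fun n => fpsC (fps_coef f n) * g ^+ n).

End FpsRing.

Notation "''q'" := (@fpsX int) : ring_scope.

(** * q-series *)

Definition qpoch (R : comNzRingType) (a q : R) (n : nat) : R :=
  \prod_(j < n) (1 - a * q ^+ j).

Definition f7_term (n : nat) : fps int :=
  (-1) ^+ n * ('q ^+ (n ^ 2 + n) * qpoch ('q ^+ 2) ('q ^+ 2) n
               / qpoch (- 'q) 'q (2 * n + 1)).

Definition f7 : fps int := fps_sum [set: nat] f7_term.

(** * Rings of integers and ideals *)

Section RingOfIntegers.
Variable L : fieldExtType rat.

Definition algint : {pred L} :=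
  fun x => `[< integralOver (intr : int -> L) x >].

Fact algint_subring : subring_closed algint.
Proof.
split=> [|x y /asboolP ix /asboolP iy|x y /asboolP ix /asboolP iy];
  apply/asboolP.
- exact: integral1.
- exact: integral_sub.
- exact: integral_mul.
Qed.

HB.instance Definition _ := GRing.isSubringClosed.Build L algint algint_subring.

Record intring := IntRing { intring_val :> L; _ : intring_val \in algint }.

HB.instance Definition _ := [isSub for intring_val].
HB.instance Definition _ := [Choice of intring by <:].
HB.instance Definition _ := [SubChoice_isSubComNzRing of intring by <:].

End RingOfIntegers.

Section Ideals.
Variable R : comNzRingType.

Definition is_ideal (I : set R) : Prop :=
  [/\ I 0, forall x y, I x -> I y -> I (x + y) & forall a x, I x -> I (a * x)].

(* The elements of [R / I], as cosets [x + I]. *)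
Definition cosets (I : set R) : set (set R) :=
  [set [set x + y | y in I] | x in [set: R]].

(* [|R / I|], and [0] if [R / I] is infinite. *)
Definition ideal_norm (I : set R) : nat := #|` fset_set (cosets I)|.

End Ideals.

(* Main.v *)
Require Import Defs.
From HB Require Import structures.
From mathcomp Require Import all_boot all_order all_algebra all_field.
From mathcomp Require Import finmap all_classical.
From mathcomp Require Import ring zify.

Set Implicit Arguments.
Unset Strict Implicit.
Unset Printing Implicit Defensive.

Import Order.TTheory GRing.Theory Num.Theory.
Local Open Scope classical_set_scope.
Local Open Scope ring_scope.

(** Both sides are generating functions of one and the same counting problem.

    On the analytic side, put Q = q^2. The coefficient 1 / (-q; q)_(2n+1) of
    the n-th term of f7 is, up to normalisation, the beta-sequence of a Bailey
    pair relative to (Q, Q), that is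
      1 / (-q; q)_(2n+1)
        = sum_(r <= n) alpha_r / ((Q; Q)_(n-r) (Q; Q)_(n+r+1)),
      alpha_r = q^(2r^2+r) (1 - q^(2r+1)) sum_(|j| <= r) (-1)^j q^(-j^2)
    ([bailey_pair]). The remaining factor (-1)^n q^(n^2+n) (Q; Q)_n is the
    delta-sequence of the limiting conjugate Bailey pair ([conj_bailey_pair]):
    summing it over n against 1 / ((Q; Q)_(n-r) (Q; Q)_(n+r+1)) gives
    (-1)^r q^(r^2+r). Exchanging the two summations turns f7 into the
    Hecke-type double sum
      f7 = sum_(r >= 0) sum_(|j| <= r)
             (-1)^(r+j) q^(3r^2+2r-j^2) (1 - q^(2r+1)).
    Both pairs are proved by creative telescoping: each sum satisfies a
    first-order recurrence because the corresponding combination of summands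
    is a difference of explicit terms.

    Each monomial q^k of the double sum carries the sign (-1)^k, and completing
    the square with x = 3r+1 (or x = 3r+2 for the terms coming from q^(2r+1))
    and y = j turns the exponent k into the equation x^2 - 3y^2 = 3k+1 with
    x > 0 and |3y| < x. So (-1)^k times the coefficient of q^k in f7 counts the
    solutions (x, y) of that equation in that cone.

    On the arithmetic side, the ring of integers of Q(sqrt 3) is Z[sqrt 3]
    ([quad_integer]), which is norm-Euclidean, so a nonzero ideal is generated
    by some x + y sqrt 3, and its norm is |x^2 - 3y^2| ([ideal_norm_princ]).
    If that norm is 1 mod 3, then x^2 - 3y^2 is positive, as -1 is not a square
    mod 3. The generators of an ideal differ by units, which are up to sign the
    powers of 2 + sqrt 3, and |3y| < x bounds a fundamental domain for the
    action of the units; its boundary |3y| = x only meets norms divisible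
    by 3. Hence each ideal of norm 3k+1 has exactly one generator in the cone
    ([fund_domain_bij]), and the two counts agree. *)

(** * A Bailey pair with beta_n = 1 / (-q; q)_(2n+1) *)

Section BaileyPair.
Variables (R : comUnitRingType) (q : R).
Hypothesis qU : forall n, 1 - q ^+ n.+1 \is a GRing.unit.

Let P n := qpoch (q ^+ 2) (q ^+ 2) n.

Lemma qpochS (a b : R) n : qpoch a b n.+1 = qpoch a b n * (1 - a * b ^+ n).
Proof. by rewrite /qpoch big_ord_recr. Qed.

Lemma qpoch2S n : P n.+1 = P n * (1 - q ^+ (2 * n.+1)).
Proof. by rewrite /P qpochS -exprS exprM. Qed.

Lemma qpoch2_unit n : P n \is a GRing.unit.
Proof.
elim: n => [|n IHn]; first by rewrite /P /qpoch big_ord0 unitr1.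
by rewrite qpoch2S unitrM IHn mulnS qU.
Qed.

Lemma qpoch2V n : (P n)^-1 = (1 - q ^+ (2 * n.+1)) * (P n.+1)^-1.
Proof.
have U : 1 - q ^+ (2 * n.+1) \is a GRing.unit by rewrite mulnS qU.
by rewrite qpoch2S invrM ?qpoch2_unit // mulVKr.
Qed.

(** This is q^(r^2) times the sum of (-1)^j q^(-j^2) over |j| <= r, indexed by
    i = r + j: then r^2 - j^2 = i (2r - i), and no negative power occurs. *)
Definition hecke r : R :=
  \sum_(i < (2 * r).+1) (-1) ^+ (r + i) * q ^+ (i * (2 * r - i)).

Lemma hecke0 : hecke 0 = 1.
Proof. by rewrite /hecke big_ord1 mulr1. Qed.

Lemma heckeS r : hecke r.+1 = q ^+ (2 * r).+1 * hecke r + 2 * (-1) ^+ r.+1.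
Proof.
rewrite /hecke mulnS big_ord_recl big_ord_recr /=.
(* the end terms have exponent 0, the others are those of hecke r times q^(2r+1) *)
under eq_bigr => i _.
  have -> : (-1) ^+ (r.+1 + bump 0 i) * q ^+ (bump 0 i * (2 + 2 * r - bump 0 i))
     = q ^+ (2 * r).+1 * ((-1) ^+ (r + i) * q ^+ (i * (2 * r - i))) :> R.
    rewrite mulrCA -exprD /bump leq0n add1n addSnnS addnS !addnS 2!exprS !mulN1r opprK.
    congr (_ * _ ^+ _); have := ltn_ord i; nia.
  over.
rewrite -mulr_sumr mul0n expr0 /bump leq0n.
have -> : (1 + (2 * r).+1 = 2 * r.+1)%N by lia.
rewrite -mulnS subnn muln0 expr0 addn0 exprD [_ ^+ (2 * r.+1)]exprM sqrrN !expr1n.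
ring.
Qed.

(** The alpha-sequence of the pair, up to the factor 1 - q^2 that turns
    (q^4; q^2)_(n+r) into (q^2; q^2)_(n+r+1) in [bailey_term]. *)
Definition bailey_alpha r := q ^+ (r ^ 2 + r) * (1 - q ^+ (2 * r).+1) * hecke r.
Definition bailey_term n r :=
  bailey_alpha r * (P (n - r))^-1 * (P (n + r).+1)^-1.

(** The partial sums over r have a closed form because the summand is
    (G(r+1) - G(r)) S_r with S_r = q^(-r^2) hecke r and
      G(r) = - q^(2n+2r^2) (q^r + q^(-r)) / ((q^2; q^2)_(n-r) (q^2; q^2)_(n+r)).
    Summing by parts leaves G(k+1) S_k, the first term in the last factor, and
    the sum of G(r) (S_r - S_(r-1)), where S_r - S_(r-1) = 2 (-1)^r q^(-r^2) for
    r >= 1; multiplied by 1 - q^(2n) it telescopes in turn and gives the second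
    one. *)
Lemma bailey_telescope n k m : n = (k + m)%N ->
  (1 - q ^+ (2 * n)) * \sum_(r < k.+1)
    ((1 + q ^+ (2 * n).+1) * (1 + q ^+ (2 * n))
      - (1 - q ^+ (2 * (n - r))) * (1 - q ^+ (2 * (n + r).+1)))
    * bailey_term n r
  = - q ^+ (2 * n) * (1 - q ^+ (2 * m)) * (P m)^-1 * (P (n + k).+1)^-1 *
    ((1 - q ^+ (2 * n)) * q ^+ (k ^ 2 + 3 * k + 1) * (1 + q ^+ (2 * k.+1)) * hecke k
     - 2 * (-1) ^+ k * q ^+ (k ^ 2 + k) * (1 - q ^+ (2 * (n + k).+1))).
Proof.
elim: k n m => [|k IHk] n m ->.
  rewrite big_ord1 /bailey_term /bailey_alpha hecke0 !add0n !addn0 subn0 !muln0.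
  rewrite !muln1 !mulnS !exprS !expr0.
  set y := q ^+ (2 * m); set u := (P _)^-1; set v := (P _)^-1.
  by ring.
rewrite big_ord_recr /= mulrDr (IHk _ m.+1); last by rewrite addnS.
rewrite /bailey_term /bailey_alpha heckeS addKn.
rewrite (qpoch2V m) (qpoch2V (k.+1 + m + k).+1).
have -> : (k.+1 + m + k.+1 = (k.+1 + m + k).+1)%N by rewrite addnS.
(* every term is now a polynomial in q, x, y, z times the two inverses u, v *)
set u := (P _)^-1; set v := (P _)^-1; set h := hecke k.
set x := q ^+ k; set y := q ^+ m; set z := q ^+ (k ^ 2).
have -> : q ^+ (2 * (k.+1 + m)).+1 = q ^+ 3 * x ^+ 2 * y ^+ 2.
  by rewrite /x /y -!exprM -!exprD; congr (_ ^+ _); lia.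
have -> : q ^+ (2 * (k.+1 + m)) = q ^+ 2 * x ^+ 2 * y ^+ 2.
  by rewrite /x /y -!exprM -!exprD; congr (_ ^+ _); lia.
have -> : q ^+ (2 * m.+1) = q ^+ 2 * y ^+ 2.
  by rewrite /x /y -!exprM -!exprD; congr (_ ^+ _); lia.
have -> : q ^+ (2 * m) = y ^+ 2.
  by rewrite /x /y -!exprM -?exprD; congr (_ ^+ _); lia.
have -> : q ^+ (k ^ 2 + 3 * k + 1) = q * x ^+ 3 * z.
  by rewrite /x /y -!exprM -?exprD -?exprS -?exprD; congr (_ ^+ _); lia.
have -> : q ^+ (2 * k.+1) = q ^+ 2 * x ^+ 2.
  by rewrite /x /y -!exprM -?exprD; congr (_ ^+ _); lia.
have -> : q ^+ (k ^ 2 + k) = x * z.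
  by rewrite /x /y -?exprM -?exprD; congr (_ ^+ _); lia.
have -> : q ^+ (2 * (k.+1 + m + k).+1) = q ^+ 4 * x ^+ 4 * y ^+ 2.
  by rewrite /x /y -!exprM -?exprD; congr (_ ^+ _); lia.
have -> : q ^+ (2 * (k.+1 + m + k).+2) = q ^+ 6 * x ^+ 4 * y ^+ 2.
  by rewrite /x /y -!exprM -?exprD; congr (_ ^+ _); lia.
have -> : q ^+ (k.+1 ^ 2 + k.+1) = q ^+ 2 * x ^+ 3 * z.
  by rewrite /x /y -!exprM -?exprD; congr (_ ^+ _); lia.
have -> : q ^+ (2 * k.+1).+1 = q ^+ 3 * x ^+ 2.
  by rewrite /x /y -!exprM -?exprD; congr (_ ^+ _); lia.
have -> : q ^+ (2 * k).+1 = q * x ^+ 2.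
  by rewrite /x /y -!exprM -?exprD -?exprS; congr (_ ^+ _); lia.
have -> : q ^+ (k.+1 ^ 2 + 3 * k.+1 + 1) = q ^+ 5 * x ^+ 5 * z.
  by rewrite /x /y -!exprM -?exprD; congr (_ ^+ _); lia.
have -> : q ^+ (2 * k.+2) = q ^+ 4 * x ^+ 2.
  by rewrite /x /y -!exprM -?exprD; congr (_ ^+ _); lia.
rewrite [(-1) ^+ k.+1]exprS mulN1r; set w := (-1) ^+ k.
ring.
Qed.

Lemma addq_unit n : 1 + q ^+ n.+1 \is a GRing.unit.
Proof.
have : 1 - q ^+ (n.+1 * 2) \is a GRing.unit by rewrite mulSn qU.
by rewrite exprM -{1}(expr1n R 2) subr_sqr unitrM => /andP[].
Qed.

Lemma qpoch_addq_unit n : qpoch (- q) q n \is a GRing.unit.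
Proof.
elim: n => [|n IHn]; first by rewrite /qpoch big_ord0 unitr1.
by rewrite qpochS unitrM IHn mulNr opprK -exprS addq_unit.
Qed.

(** The closed form of [bailey_telescope] vanishes once r has run over its whole
    range, which leaves the recurrence satisfied by 1 / (-q; q)_(2n+1). *)
Lemma bailey_recurrence n :
  (1 + q ^+ (2 * n.+1).+1) * (1 + q ^+ (2 * n.+1))
    * (\sum_(r < n.+2) bailey_term n.+1 r) = \sum_(r < n.+1) bailey_term n r.
Proof.
have := @bailey_telescope n.+1 n.+1 0 (esym (addn0 _)).
rewrite muln0 expr0 subrr mulr0 !mul0r => /(canRL (mulKr _)).
rewrite mulr0 {1}mulnS qU => /(_ isT).
under eq_bigr do rewrite mulrBl.
rewrite sumrB => /subr0_eq; rewrite -mulr_sumr => ->.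
rewrite big_ord_recr /= subnn muln0 expr0 subrr !mul0r addr0.
apply: eq_bigr => r _; rewrite /bailey_term.
rewrite (qpoch2V (n - r)) (qpoch2V (n + r).+1) -subSn ?addSn; last by rewrite -ltnS.
ring.
Qed.

Lemma bailey_pair n :
  \sum_(r < n.+1) bailey_term n r = (qpoch (- q) q (2 * n + 1))^-1.
Proof.
elim: n => [|n IHn].
  rewrite big_ord1 /bailey_term /bailey_alpha hecke0 subnn !muln0 !add0n !mulr1.
  rewrite qpoch2S /P !qpochS /qpoch !big_ord0 /=
    muln1 expr0 expr1 invr1 !mul1r !mulr1 opprK.
  have U1 : 1 - q \is a GRing.unit by have := qU 0; rewrite expr1.
  have U2 : 1 + q \is a GRing.unit by have := addq_unit 0; rewrite expr1.
  have -> : 1 - q ^+ 2 = (1 + q) * (1 - q) by ring.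
  by rewrite invrM // mulVKr.
have -> : (2 * n.+1 + 1 = (2 * n + 1).+2)%N by lia.
have U : (1 + q ^+ (2 * n.+1)) * (1 + q ^+ (2 * n.+1).+1) \is a GRing.unit.
  by rewrite unitrM mulnS !addq_unit.
rewrite !qpochS !mulNr !opprK -!exprS.
have -> : ((2 * n + 1).+1 = 2 * n.+1)%N by lia.
rewrite -mulrA invrM ?qpoch_addq_unit //.
rewrite -[X in _ * X]IHn -[X in _ * X]bailey_recurrence.
by rewrite [X in X * (\sum_(r < _) _)]mulrC mulKr.
Qed.

(** The summand of the conjugate pair, with the convention that
    1 / (q^2; q^2)_m vanishes for m < 0. *)
Definition conj_bailey_term n r :=
  (-1) ^+ n * q ^+ (n ^ 2 + n) * P n *
  (if (r <= n)%N then (P (n - r))^-1 * (P (n + r).+1)^-1 else 0).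

(** The telescoping certificate of the recurrence in r for the sums of
    [conj_bailey_term] over n. *)
Definition conj_bailey_cert n r :=
  (-1) ^+ n * q ^+ (n ^ 2 + n) * P n *
  (if (r < n)%N then (P (n - r.+1))^-1 * (P (n + r).+1)^-1 else 0).

Lemma conj_bailey_step n r :
  q ^+ (2 * r.+1) * conj_bailey_term n r + conj_bailey_term n r.+1 =
  (1 + q ^+ (2 * r.+1)) * (conj_bailey_cert n r - conj_bailey_cert n.+1 r).
Proof.
rewrite /conj_bailey_term /conj_bailey_cert ltnS (qpoch2S n).
have [ltnr|lern] := ltnP n r; first by rewrite ltnNge ltnW // !mulr0; ring.
(* the convention at n = r agrees with the factor 1 - q^(2(n-r)) *)
have vanish (u : R) : (if (r < n)%N then (P (n - r.+1))^-1 * u else 0)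
    = (1 - q ^+ (2 * (n - r))) * (P (n - r))^-1 * u.
  case: ltnP => [ltrn|lenr]; last first.
    have -> : (n - r = 0)%N by lia.
    by rewrite muln0 expr0 subrr !mul0r.
  by rewrite (qpoch2V (n - r.+1)) -subSn // subSS.
rewrite !vanish subSS addSn addnS (qpoch2V (n + r).+1).
set u := (P _)^-1; set v := (P (_.+2))^-1; set p := P n; set w := _ ^+ n.
have -> : (-1) ^+ n.+1 = - w :> R by rewrite exprS mulN1r.
have [m ->] : exists m, n = (r + m)%N by exists (n - r)%N; lia.
rewrite addKn; set x := q ^+ r; set y := q ^+ m; set z := q ^+ ((r + m) ^ 2 + (r + m)).
have -> : q ^+ (2 * r.+1) = q ^+ 2 * x ^+ 2.
  by rewrite /x /y -!exprM -?exprD; congr (_ ^+ _); lia.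
have -> : q ^+ (2 * m) = y ^+ 2.
  by rewrite /x /y -!exprM -?exprD; congr (_ ^+ _); lia.
have -> : q ^+ (2 * (r + m).+1) = q ^+ 2 * x ^+ 2 * y ^+ 2.
  by rewrite /x /y -!exprM -?exprD; congr (_ ^+ _); lia.
have -> : q ^+ (2 * (r + m + r).+2) = q ^+ 4 * x ^+ 4 * y ^+ 2.
  by rewrite /x /y -!exprM -?exprD; congr (_ ^+ _); lia.
have -> : q ^+ ((r + m).+1 ^ 2 + (r + m).+1) = q ^+ 2 * x ^+ 2 * y ^+ 2 * z.
  by rewrite /x /y /z -!exprM -?exprD; congr (_ ^+ _); lia.
ring.
Qed.

Lemma conj_bailey_sum0 K :
  \sum_(n < K) conj_bailey_term n 0
    = 1 - (-1) ^+ K * q ^+ (K ^ 2 + K) * (P K)^-1.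
Proof.
elim: K => [|K IHK].
  by rewrite big_ord0 /P /qpoch big_ord0 invr1 !expr0 !mulr1 subrr.
rewrite big_ord_recr /= IHK /conj_bailey_term leq0n subn0 addn0.
rewrite mulrA mulrK ?qpoch2_unit // (qpoch2V K) [(-1) ^+ K.+1]exprS mulN1r.
have -> : q ^+ (K.+1 ^ 2 + K.+1) = q ^+ (2 * K.+1) * q ^+ (K ^ 2 + K).
  by rewrite -exprD; congr (_ ^+ _); lia.
ring.
Qed.

(** Summing [conj_bailey_step] over n < K relates the sums for r and r+1 up to
    the certificate at n = K, which is divisible by q^(K^2+K); so the tail of
    the sum over n is too. *)
Lemma conj_bailey_pair K r : exists e : R,
  \sum_(n < K) conj_bailey_term n r
    = (-1) ^+ r * q ^+ (r ^ 2 + r) + q ^+ (K ^ 2 + K) * e.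
Proof.
elim: r => [|r [e IHr]].
  exists (- (-1) ^+ K * (P K)^-1); rewrite conj_bailey_sum0 !expr0; ring.
have tele : q ^+ (2 * r.+1) * (\sum_(n < K) conj_bailey_term n r)
    + \sum_(n < K) conj_bailey_term n r.+1
    = - (1 + q ^+ (2 * r.+1)) * conj_bailey_cert K r.
  rewrite mulr_sumr -big_split /=.
  under eq_bigr do rewrite conj_bailey_step.
  rewrite -mulr_sumr mulNr -mulrN; congr (_ * _).
  elim: (K) => [|k IHk]; first by rewrite big_ord0 /conj_bailey_cert mulr0 oppr0.
  by rewrite big_ord_recr /= IHk addrA addNr add0r.
have /(canRL (addKr _)) := tele; rewrite IHr => ->.
have -> : q ^+ (r.+1 ^ 2 + r.+1) = q ^+ (2 * r.+1) * q ^+ (r ^ 2 + r).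
  by rewrite -exprD; congr (_ ^+ _); lia.
rewrite /conj_bailey_cert [(-1) ^+ r.+1]exprS mulN1r.
set d := if _ then _ else _.
exists (- q ^+ (2 * r.+1) * e - (1 + q ^+ (2 * r.+1)) * ((-1) ^+ K * P K * d)).
ring.
Qed.

(** Bailey's lemma for the two pairs, truncated at K so that the exchange of
    summations is finite. *)
Lemma bailey_sum K : exists e : R,
  \sum_(n < K) (-1) ^+ n * (q ^+ (n ^ 2 + n) * P n / qpoch (- q) q (2 * n + 1))
    = \sum_(r < K) (-1) ^+ r * q ^+ (r ^ 2 + r) * bailey_alpha r
      + q ^+ (K ^ 2 + K) * e.
Proof.
have /fin_all_exists [e eE] (r : 'I_K) := conj_bailey_pair K r.
exists (\sum_(r < K) bailey_alpha r * e r).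
rewrite mulr_sumr -big_split /=.
under [RHS]eq_bigr => r _.
  have -> : (-1) ^+ r * q ^+ (r ^ 2 + r) * bailey_alpha r
      + q ^+ (K ^ 2 + K) * (bailey_alpha r * e r)
      = \sum_(n < K) bailey_alpha r * conj_bailey_term n r.
    by rewrite -mulr_sumr eE; ring.
  over.
rewrite exchange_big /=; apply: eq_bigr => n _.
rewrite !mulrA -bailey_pair mulr_sumr (big_ord_widen K (fun r => _ * bailey_term n r)) //.
rewrite big_mkcond /=; apply: eq_bigr => r _; rewrite /conj_bailey_term /bailey_term ltnS.
by case: ifP => _; rewrite ?mulr0 //; ring.
Qed.

End BaileyPair.

(** * Coefficients of formal power series *)

Section FpsCoef.
Variable R : comUnitRingType.
Implicit Types f g : fps R.

Lemma fps_coef_sum (I : Type) (s : seq I) (p : pred I) (F : I -> fps R) n :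
  fps_coef (\sum_(i <- s | p i) F i) n = \sum_(i <- s | p i) fps_coef (F i) n.
Proof. by elim/big_rec2: _ => // i x y _ <-. Qed.

Lemma fps_coefXM f n :
  fps_coef (fpsX R * f) n = if n is m.+1 then fps_coef f m else 0.
Proof.
case: n => [|n]; rewrite [LHS]/=; first by rewrite big_ord1 mul0r.
rewrite !big_ord_recl big1 => [|i _]; last by rewrite mul0r.
by rewrite mul0r mul1r add0r addr0 subSS subn0.
Qed.

Lemma fps_coefXnM f m n :
  fps_coef (fpsX R ^+ m * f) n = if (m <= n)%N then fps_coef f (n - m) else 0.
Proof.
elim: m n => [|m IHm] n; first by rewrite expr0 mul1r subn0.
by rewrite exprS -mulrA fps_coefXM; case: n => // n; rewrite IHm.
Qed.

Lemma fps_coefXn m n : fps_coef (fpsX R ^+ m) n = (n == m)%:R.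
Proof.
rewrite -[_ ^+ m]mulr1 fps_coefXnM eqn_leq andbC.
by case: leqP => //= lemn; rewrite subn_eq0.
Qed.

Lemma fps_coefN f n : fps_coef (- f) n = - fps_coef f n.
Proof. by []. Qed.

Lemma fps_coefD f g n : fps_coef (f + g) n = fps_coef f n + fps_coef g n.
Proof. by []. Qed.

Lemma fps_coef_signM f m n : fps_coef ((-1) ^+ m * f) n = (-1) ^+ m * fps_coef f n.
Proof. by elim: m => [|m IHm]; rewrite ?mul1r // !exprS !mulN1r !mulNr fps_coefN IHm. Qed.

Lemma fps_unit_subX n : 1 - fpsX R ^+ n.+1 \is a GRing.unit.
Proof.
suff : fps_coef (1 - fpsX R ^+ n.+1) 0 \is a GRing.unit by [].
by rewrite fps_coefD fps_coefN fps_coefXn subr0 unitr1.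
Qed.

Lemma fps_coefCM (c : R) f n :
  fps_coef (fpsC c * f) n = c * fps_coef f n.
Proof.
rewrite [LHS]/= big_ord_recl big1 => [|j _]; last by rewrite mul0r.
by rewrite addr0 subn0.
Qed.

Lemma fps_coef_fsum (I : choiceType) (A : set I)
  (F : I -> fps R) n : fps_coef (fps_sum A F) n = \sum_(i \in A) fps_coef (F i) n.
Proof. by []. Qed.

Lemma fps_comp_Xn f d n : (0 < d)%N ->
  fps_coef (fps_comp f (fpsX R ^+ d)) n
    = if (d %| n)%N then fps_coef f (n %/ d) else 0.
Proof.
move=> d0; rewrite /fps_comp fps_coef_fsum.
have coefE i : fps_coef (fpsC (fps_coef f i) * (fpsX R ^+ d) ^+ i) n
    = if n == (d * i)%N then fps_coef f i else 0.
  by rewrite fps_coefCM -exprM fps_coefXn; case: eqP; rewrite ?mulr1 ?mulr0.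
under eq_fsbigr do rewrite coefE.
rewrite (fsbigTE [fset (n %/ d)%N]%fset) => [|i].
  by rewrite big_seq_fset1 mulnC dvdn_eq eq_sym.
by rewrite inE => ni; case: eqP => // nE; move: ni; rewrite nE mulKn // eqxx.
Qed.

End FpsCoef.

(** * The coefficients of f7 *)

(** With j = i - r this is 3r^2 + 2r - j^2 for e = 0, and e = 1 adds the
    2r + 1 of the factor 1 - q^(2r+1). *)
Definition f7_exponent (r i e : nat) : nat :=
  2 * r ^ 2 + 2 * r + e * (2 * r).+1 + i * (2 * r - i).

Lemma f7_term_coef n k : (k < n ^ 2 + n)%N -> fps_coef (f7_term n) k = 0.
Proof.
by move=> ltkn; rewrite /f7_term fps_coef_signM -mulrA fps_coefXnM leqNgt ltkn mulr0.
Qed.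

Lemma f7_summable : fps_summable [set: nat] f7_term.
Proof.
move=> k; apply: (sub_finite_set _ (finite_II k.+1)) => n [_ /=].
apply: contraNT; rewrite -leqNgt => ltkn; apply/eqP/f7_term_coef; lia.
Qed.

Lemma f7_coefE k :
  fps_coef f7 k = \sum_(n < k.+1) fps_coef (f7_term n) k.
Proof.
rewrite /f7 /fps_sum [LHS]/= (fsbig_ord _ _ (fun n => fps_coef (f7_term n) k)).
apply/esym/fsbig_widen => // n [_ /= /negP]; rewrite -leqNgt => ltkn.
by apply: f7_term_coef; lia.
Qed.

(** The monomials q^k of the double sum. Since i <= 2r <= f7_exponent r i e,
    the bounds of the finite type lose none of them. *)
Definition f7_index k : {pred 'I_k.+1 * 'I_(2 * k).+1 * bool} :=
  fun t => (t.1.2 <= 2 * t.1.1)%N && (f7_exponent t.1.1 t.1.2 t.2 == k).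

Arguments f7_index : clear implicits.

(** A monomial of the double sum has sign (-1)^(i+e), and i + e has the parity of
    its exponent f7_exponent r i e, so no two monomials q^k cancel. *)
Lemma hecke_term_coef k r :
  fps_coef ((-1) ^+ r * 'q ^+ (r ^ 2 + r) * bailey_alpha 'q r) k
  = \sum_(i < (2 * r).+1) \sum_(e : bool)
      if f7_exponent r i e == k then (-1) ^+ k else 0.
Proof.
rewrite /bailey_alpha /hecke !mulr_sumr fps_coef_sum; apply: eq_bigr => i _.
rewrite big_bool [RHS]/=.
transitivity (fps_coef ((-1) ^+ i * ('q ^+ f7_exponent r i false - 'q ^+ f7_exponent r i true)) k).
  apply: (congr1 (fun f : fps int => fps_coef f k)).
  have -> : 'q ^+ f7_exponent r i false
      = 'q ^+ (r ^ 2 + r) * 'q ^+ (r ^ 2 + r) * 'q ^+ (i * (2 * r - i)).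
    by rewrite -!exprD; congr (_ ^+ _); rewrite /f7_exponent; lia.
  have -> : 'q ^+ f7_exponent r i true
      = 'q ^+ (r ^ 2 + r) * 'q ^+ (r ^ 2 + r) * 'q ^+ (2 * r).+1
        * 'q ^+ (i * (2 * r - i)).
    by rewrite -!exprD; congr (_ ^+ _); rewrite /f7_exponent; lia.
  have -> : (-1) ^+ (r + i) = (-1) ^+ r * (-1) ^+ i :> fps int by rewrite exprD.
  have : (-1) ^+ r * (-1) ^+ r = 1 :> fps int by rewrite -exprD addnn -mul2n exprM sqrrN !expr1n.
  set w := (-1) ^+ r => ww.
  set a := 'q ^+ (_ + _); set b := 'q ^+ (_ * _); set c := 'q ^+ _.+1; set d := _ ^+ i.
  by transitivity (w * w * (a * a * (1 - c) * d * b)); [ring | rewrite ww; ring].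
rewrite fps_coef_signM fps_coefD fps_coefN !fps_coefXn ![k == _]eq_sym.
have parity (e : bool) : f7_exponent r i e = k -> (-1) ^+ k = (-1) ^+ (i + e) :> int.
  move=> <-; rewrite -signr_odd -[RHS]signr_odd; congr (_ ^+ nat_of_bool _).
  have lei : (i <= 2 * r)%N by rewrite -ltnS.
  move: (i : nat) lei => j lej.
  rewrite /f7_exponent -[(2 * r).+1]addn1 !(oddD, oddM) oddB // oddM /=.
  by rewrite andbT !oddb andbb addbC.
have [Ek|_] := eqVneq (f7_exponent r i true) k;
  have [Ek'|_] := eqVneq (f7_exponent r i false) k.
- by move: Ek'; rewrite -Ek /f7_exponent; lia.
- by rewrite (parity true Ek) exprD /=; ring.
- by rewrite (parity false Ek') addn0 /=; ring.
- by rewrite /=; ring.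
Qed.

Lemma f7_coef k : fps_coef f7 k = \sum_(t | f7_index k t) (-1) ^+ k.
Proof.
have [e eE] := bailey_sum (@fps_unit_subX int) k.+1.
have -> : fps_coef f7 k = \sum_(r < k.+1) \sum_(i < (2 * r).+1) \sum_(e : bool)
      if f7_exponent r i e == k then (-1) ^+ k else 0.
  under eq_bigr do rewrite -hecke_term_coef.
  rewrite f7_coefE -!fps_coef_sum /f7_term eE.
  rewrite fps_coefD -[RHS]addr0; congr (_ + _).
  by rewrite fps_coefXnM ifF //; apply/negbTE; rewrite -ltnNge; lia.
under eq_bigr => r _.
  rewrite (big_ord_widen (2 * k).+1 (fun i => \sum_(e : bool)
      if f7_exponent r i e == k then (-1) ^+ k else 0)); last first.
    by have := ltn_ord r; lia.
  rewrite big_mkcond /=.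
  over.
rewrite pair_big [RHS]big_mkcond /=.
rewrite -(pair_bigA _ (fun p e => if f7_index k (p, e) then (-1) ^+ k else 0)) /=.
apply: eq_bigr => -[r i] _; rewrite /f7_index /= ltnS.
by case: ifP => // _; rewrite big1.
Qed.

(** * The integers of Q(sqrt 3) *)

(** The exponent of 3 is even on the left and odd on the right. *)
Lemma sqr_eq3M (x y : int) : x ^+ 2 = 3 * y ^+ 2 -> x = 0 /\ y = 0.
Proof.
have [->|y0] := eqVneq y 0; first by rewrite expr0n mulr0 => /eqP; rewrite sqrf_eq0 => /eqP.
have [->|x0] := eqVneq x 0.
  by rewrite expr0n => /esym/eqP; rewrite mulf_eq0 /= sqrf_eq0 (negPf y0).
move=> /(congr1 absz); rewrite abszM !abszX => /(congr1 (logn 3)).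
rewrite lognM ?expn_gt0 ?absz_gt0 ?y0 // !lognX (pfactorK 1) //; lia.
Qed.

Lemma rat_sqrM_denq (x : rat) : x ^+ 2 * (denq x)%:~R ^+ 2 = (numq x ^+ 2)%:~R.
Proof.
by rewrite -exprMn -{1}(divq_num_den x) divfK ?intr_eq0 ?denq_neq0 // rmorphXn.
Qed.

Lemma rat_sqr_neq3 (x : rat) : x ^+ 2 != 3.
Proof.
apply/eqP => xx; have := rat_sqrM_denq x; rewrite xx => H.
have /esym/sqr_eq3M[_ /eqP] : 3 * denq x ^+ 2 = numq x ^+ 2.
  by apply: (@intr_inj rat); rewrite -H rmorphM rmorphXn.
by rewrite (negPf (denq_neq0 x)).
Qed.

(** The square of the denominator would divide 3. *)
Lemma rat_int_sqr3 (x : rat) (n : int) :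
  3 * x ^+ 2 = n%:~R -> exists m : int, x = m%:~R.
Proof.
move=> xx; have := congr1 (fun y => 3 * y) (rat_sqrM_denq x); rewrite /= mulrA xx => H.
have {}H : 3 * numq x ^+ 2 = n * denq x ^+ 2.
  by apply: (@intr_inj rat); rewrite [RHS]rmorphM rmorphXn H rmorphM.
have : (denq x ^+ 2 %| 3 * numq x ^+ 2)%Z by rewrite H dvdz_mull.
rewrite Gauss_dvdzl => [d3|]; last first.
  by rewrite coprimez_pexpr // coprimez_pexpl // coprimez_sym; exact: coprime_num_den.
have d1 : denq x = 1 by have := @dvdn_leq _ 3 isT d3; rewrite abszX; have := denq_gt0 x; nia.
by exists (numq x); rewrite -[LHS]divq_num_den d1 divr1.
Qed.

(** Gauss's lemma, in the form that gives the integrality of the trace and the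
    norm of an algebraic integer. *)
Lemma monic_dvdp_int (p : {poly int}) (d : {poly rat}) :
  p \is monic -> d \is monic -> d %| map_poly intr p ->
  forall i, exists n : int, d`_i = n%:~R.
Proof.
move=> pm dm /dvdpP_rat_int[p1 [a a0 dE] [r pE]] i.
have := pm; rewrite pE monicE lead_coefM => /eqP lead1.
have lead2 : lead_coef p1 ^+ 2 = 1.
  have /eqP : (`|lead_coef p1| * `|lead_coef r| = 1)%N by rewrite -abszM lead1.
  by rewrite muln_eq1 => /andP[/eqP l1 _]; nia.
have aE : a = (lead_coef p1)%:~R.
  have := dm; rewrite dE monicE lead_coefZ lead_coef_map_inj //; last exact: intr_inj.
  move=> /eqP a1; have lead2' : (lead_coef p1)%:~R * (lead_coef p1)%:~R = 1 :> rat.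
    by rewrite -rmorphM -expr2 lead2.
  by rewrite -[LHS]mulr1 -{1}lead2' mulrA a1 mul1r.
by exists (lead_coef p1 * p1`_i); rewrite dE coefZ coef_map aE rmorphM.
Qed.

Section QuadraticField.
Variables (L : fieldExtType rat) (s : L).
Hypotheses (hs : s ^+ 2 = 3) (hL : <<1%VS; s>>%VS = fullv).

Lemma horner_deg1 (p : {poly rat}) (z : L) : (size p <= 2)%N ->
  (map_poly (in_alg L) p).[z] = (p`_0)%:A + p`_1 *: z.
Proof.
move=> sp; rewrite (@horner_coef_wide _ 2) ?size_map_poly //.
by rewrite big_ord_recl big_ord1 !coef_map /= mulr1 -scalerAl mul1r.
Qed.

(** X^2 - t X + n, the characteristic polynomial of an element of trace t and
    norm n. *)
Definition quad_poly (t n : rat) : {poly rat} := Poly [:: n; - t; 1].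

Lemma quad_polyE (t n : rat) : quad_poly t n = [:: n; - t; 1] :> seq rat.
Proof. by rewrite /quad_poly (PolyK (c := 0)) //= oner_eq0. Qed.

Lemma horner_quad_poly (t n : rat) (z : L) :
  (map_poly (in_alg L) (quad_poly t n)).[z] = n%:A - t *: z + z ^+ 2.
Proof.
rewrite (@horner_coef_wide _ 3) ?size_map_poly ?quad_polyE //.
rewrite 2!big_ord_recl big_ord1 !coef_map /= quad_polyE /=.
by rewrite mulr1 -!scalerAl !mul1r scale1r scaleNr addrA.
Qed.

Lemma horner_mod_quad (t n : rat) (p : {poly rat}) (z : L) :
  n%:A - t *: z + z ^+ 2 = 0 ->
  (map_poly (in_alg L) p).[z]
    = ((p %% quad_poly t n)`_0)%:A + (p %% quad_poly t n)`_1 *: z.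
Proof.
move=> z0; rewrite {1}(divp_eq p (quad_poly t n)) rmorphD rmorphM hornerD hornerM.
rewrite horner_quad_poly z0 mulr0 add0r horner_deg1 //.
have d0 : quad_poly t n != 0 by rewrite -size_poly_eq0 quad_polyE.
by have := ltn_modpN0 p d0; rewrite quad_polyE.
Qed.

Lemma quad_span (z : L) : exists a b : rat, z = a%:A + b *: s.
Proof.
have /Fadjoin1_polyP[p ->] : z \in <<1; s>>%VS by rewrite hL memvf.
rewrite (@horner_mod_quad 0 (-3)); first by do 2 eexists.
by rewrite hs scale0r subr0 scaleNr scaler_nat addNr.
Qed.

Lemma quad_free (a b : rat) : a%:A + b *: s = 0 -> a = 0 /\ b = 0.
Proof.
have [->|b0] := eqVneq b 0.
  by rewrite scale0r addr0 => /eqP; rewrite scaler_eq0 oner_eq0 orbF => /eqP.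
move=> H; exfalso.
have sE : s = in_alg L (- a / b).
  apply: (scalerI b0); rewrite scalerA mulrCA divff // mulr1 scaleNr.
  by apply/eqP; rewrite -addr_eq0 addrC H.
move: (hs); rewrite sE -rmorphXn -[3](rmorph_nat (in_alg L)) => /fmorph_inj /eqP.
by rewrite (negPf (rat_sqr_neq3 _)).
Qed.

(** The minimal polynomial of z = a + b sqrt 3 divides a monic integral one. It
    is X - a if b = 0; otherwise its coefficients A = -2a and a^2 - 3b^2 are
    integers. Then 3 (2b)^2 is one too, hence so is
    B = 2b, and A^2 - 3B^2 = 0 mod 4 forces A and B to be even. *)
Lemma quad_integer (a b : rat) : a%:A + b *: s \in @algint L ->
  exists m n : int, a = m%:~R /\ b = n%:~R.
Proof.
set z := _ + _ => /asboolP[p pm pz].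
have pE : map_poly (intr : int -> L) p = map_poly (in_alg L) (map_poly intr p).
  by rewrite -map_poly_comp; apply: eq_map_poly => n /=; rewrite scaler_int.
have [b0|b0] := eqVneq b 0.
  have : root (map_poly intr p) a.
    move: pz; rewrite pE /z b0 scale0r addr0 /root.
    by rewrite -[a%:A]/(in_alg L a) horner_map fmorph_eq0.
  rewrite -dvdp_XsubCl => /monic_dvdp_int -/(_ pm (monicXsubC a) 0)[n].
  rewrite coefB coefX coefC sub0r => aE; exists (- n), 0.
  by rewrite b0 rmorphN /= -aE opprK.
(* b != 0: the minimal polynomial is quad_poly t n *)
pose t := 2 * a; pose n := a ^+ 2 - 3 * b ^+ 2.
have z0 : n%:A - t *: z + z ^+ 2 = 0.
  have scE (x : rat) (y : L) : x *: y = in_alg L x * y by rewrite mulr_algl.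
  rewrite /z /n /t !scE !mulr1 rmorphB !rmorphXn !rmorphM !(rmorph_nat (in_alg L)).
  transitivity (in_alg L b ^+ 2 * (s ^+ 2 - 3)); last by rewrite hs subrr mulr0.
  by ring.
have : quad_poly t n %| map_poly intr p.
  move: pz; rewrite pE /root (horner_mod_quad _ z0) /z scalerDr !scalerA addrA -scalerDl.
  set r := _ %% _ => /eqP/quad_free[r0 /eqP]; rewrite mulf_eq0 (negPf b0) orbF => /eqP r1.
  have sr : (size r <= 2)%N.
    have d0 : quad_poly t n != 0 by rewrite -size_poly_eq0 quad_polyE.
    by have := ltn_modpN0 (map_poly intr p) d0; rewrite quad_polyE.
  move: r0; rewrite r1 mul0r addr0 => r0; rewrite /dvdp -/r; apply/eqP/polyP => i.
  rewrite coef0; case: i => [|[|i]] //; apply: nth_default; exact: leq_trans sr _.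
have dm : quad_poly t n \is monic by rewrite monicE /lead_coef quad_polyE.
move=> /monic_dvdp_int -/(_ pm dm) dI.
have [A] := dI 1; rewrite quad_polyE /= => AE.
have [M] := dI 0; rewrite quad_polyE /= => ME.
have [B BE] : exists B : int, 2 * b = B%:~R.
  apply: (@rat_int_sqr3 _ (A ^+ 2 - 4 * M)); rewrite rmorphB rmorphXn rmorphM /= -AE -ME.
  by rewrite /t /n; ring.
have AB : A ^+ 2 - 3 * B ^+ 2 = 4 * M.
  apply: (@intr_inj rat); rewrite rmorphB rmorphXn !rmorphM /= -AE -ME -BE.
  by rewrite /t /n; ring.
have [A2 B2] : (A = 2 * (A %/ 2)%Z) /\ (B = 2 * (B %/ 2)%Z).
  have hA := divz_eq A 2; have hB := divz_eq B 2.
  have : (A %% 2)%Z = 0 \/ (A %% 2)%Z = 1 by lia.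
  have : (B %% 2)%Z = 0 \/ (B %% 2)%Z = 1 by lia.
  move: hA hB; set x := (A %/ 2)%Z; set y := (B %/ 2)%Z => hA hB.
  move=> [eB|eB] [eA|eA]; rewrite eA in hA; rewrite eB in hB;
    by move: AB; rewrite hA hB; nia.
exists (- (A %/ 2)%Z), (B %/ 2)%Z.
have two : (2 : rat) != 0 by [].
split; apply: (mulfI two); first by rewrite -/t -[t]opprK AE {1}A2 rmorphM rmorphN mulrN.
by rewrite BE {1}B2 rmorphM.
Qed.

End QuadraticField.

(** * Ideals of Z[sqrt 3] and their norms *)

Section IdealCosets.
Variables (R : comNzRingType) (I : set R).
Hypothesis idI : is_ideal I.

Lemma is_idealB x y : I x -> I y -> I (x - y).
Proof. by case: idI => _ addI mulI Ix Iy; apply: addI => //; rewrite -mulN1r; apply: mulI. Qed.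

Lemma coset_eqP x y : [set x + z | z in I] = [set y + z | z in I] <-> I (x - y).
Proof.
case: (idI) => I0 addI mulI; split=> [Exy|Ixy].
  have : [set y + z | z in I] x by rewrite -Exy; exists 0; rewrite ?addr0.
  by move=> [z Iz <-]; rewrite addrC addKr.
apply/seteqP; split=> _ [z Iz <-].
  by exists (x - y + z); [apply: addI | ring].
by exists (z - (x - y)); [apply: is_idealB | ring].
Qed.

End IdealCosets.

(** The ring of integers enters through three properties, established for it in
    [intring_sqr], [intring_span] and [intring_free]; from them on, ideals are
    treated as lattices in Z^2. *)
Section SqrtThree.
Variables (O : comNzRingType) (w : O).
Hypothesis w2 : w ^+ 2 = 3.
Hypothesis basis_span : forall z : O, exists a b : int, z = a%:~R + b%:~R * w.
Hypothesis basis_free : forall a b : int, a%:~R + b%:~R * w = 0 -> a = 0 /\ b = 0.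

Definition elt (a b : int) : O := a%:~R + b%:~R * w.

Lemma eltB a b c d : elt a b - elt c d = elt (a - c) (b - d).
Proof. by rewrite /elt !rmorphB /=; ring. Qed.

Lemma eltM a b c d : elt a b * elt c d = elt (a * c + 3 * b * d) (b * c + a * d).
Proof.
rewrite /elt !rmorphD !rmorphM /=.
transitivity (a%:~R * c%:~R + b%:~R * d%:~R * w ^+ 2 + (b%:~R * c%:~R + a%:~R * d%:~R) * w).
  by ring.
by rewrite w2; ring.
Qed.

Lemma elt_eq0 a b : elt a b = 0 -> a = 0 /\ b = 0.
Proof. exact: basis_free. Qed.

Lemma elt_inj a b c d : elt a b = elt c d -> a = c /\ b = d.
Proof.
by move/eqP; rewrite -subr_eq0 eltB => /eqP/elt_eq0[/subr0_eq -> /subr0_eq ->].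
Qed.

Definition nrm (a b : int) : int := a ^+ 2 - 3 * b ^+ 2.

Lemma nrm_eq0 a b : nrm a b = 0 -> a = 0 /\ b = 0.
Proof. by move=> /subr0_eq /sqr_eq3M. Qed.

Lemma nrmM a b c d : nrm (a * c + 3 * b * d) (b * c + a * d) = nrm a b * nrm c d.
Proof. rewrite /nrm; ring. Qed.

Definition princ (a b : int) : set O := [set elt a b * z | z in [set: O]].

Lemma princ_is_ideal a b : is_ideal (princ a b).
Proof.
split; first by exists 0; rewrite ?mulr0.
- by move=> _ _ [x _ <-] [y _ <-]; exists (x + y); rewrite ?mulrDr.
- by move=> c _ [x _ <-]; exists (c * x); rewrite // mulrCA.
Qed.

Lemma mem_princ a b u v : princ a b (elt u v) <->
  exists x y, u = a * x + 3 * b * y /\ v = b * x + a * y.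
Proof.
split=> [[z _]|[x [y [-> ->]]]]; last by exists (elt x y); rewrite ?eltM.
have [x [y ->]] := basis_span z; rewrite -/(elt x y) eltM => /elt_inj[<- <-].
by exists x, y.
Qed.

(** The nearest multiple t n of n is at distance at most |n| / 2. *)
Lemma nearest_multiple (x n : int) : n != 0 -> exists t, 4 * (x - t * n) ^+ 2 <= n ^+ 2.
Proof.
wlog n0 : n / 0 < n => [H n0|_].
  have [/H|] := ltrP 0 n; first exact.
  rewrite le_eqVlt (negPf n0) /= -oppr_gt0 => ngt0.
  have [t tP] := H _ ngt0 (lt0r_neq0 ngt0); exists (- t).
  by rewrite mulNr -mulrN -[leRHS]sqrrN.
exists ((2 * x + n) %/ (2 * n))%Z.
have := divz_eq (2 * x + n) (2 * n); have := @ltz_pmod (2 * x + n) (2 * n).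
have := @modz_ge0 (2 * x + n) (2 * n).
set t := (_ %/ _)%Z; set r := (_ %% _)%Z => r0 rn E.
have {}r0 : 0 <= r by apply: r0; lia.
have {}rn : r < 2 * n by apply: rn; lia.
have -> : 4 * (x - t * n) ^+ 2 = (r - n) ^+ 2.
  have -> : r = 2 * x + n - t * (2 * n) by lia.
  by ring.
nia.
Qed.

(** Division by a + b w: rounding both coordinates of the exact quotient leaves
    an error p + r w with |p|, |r| <= 1/2, and |p^2 - 3r^2| <= 3/4 < 1. *)
Lemma nrm_euclid a b u v : nrm a b != 0 -> exists x y,
  `|nrm (u - (a * x + 3 * b * y)) (v - (b * x + a * y))| < `|nrm a b|.
Proof.
move=> n0; have [x Hx] := nearest_multiple (u * a - 3 * v * b) n0.
have [y Hy] := nearest_multiple (v * a - u * b) n0.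
(* multiply by the norm to stay within the integers *)
exists x, y; rewrite -(ltr_pM2r (x := `|nrm a b|)) ?normr_gt0 // -normrM.
have -> : nrm (u - (a * x + 3 * b * y)) (v - (b * x + a * y)) * nrm a b
  = (u * a - 3 * v * b - x * nrm a b) ^+ 2 - 3 * (v * a - u * b - y * nrm a b) ^+ 2.
  by rewrite /nrm; ring.
rewrite -normrM -expr2 [ltRHS]ger0_norm ?sqr_ge0 //.
have : 0 < nrm a b ^+ 2 by rewrite exprn_even_gt0.
move: Hx Hy; set p := (_ - x * _) ^+ 2; set r := (_ - y * _) ^+ 2.
have p0 : 0 <= p by rewrite sqr_ge0.
have r0 : 0 <= r by rewrite sqr_ge0.
by move: (nrm a b ^+ 2) => N2; lia.
Qed.

(** A nonzero element of least norm generates the ideal. *)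
Lemma ideal_princ (I : set O) : is_ideal I -> I <> [set 0] ->
  exists a b, nrm a b != 0 /\ I = princ a b.
Proof.
move=> idI I0; case: (idI) => zI addI mulI.
pose size_of n := `[< exists a b, [/\ I (elt a b), nrm a b != 0 & `|nrm a b|%N = n] >].
have exN : exists n, size_of n.
  apply: contrapT => none; apply: I0; apply/seteqP; split=> z /=; last by move->.
  move=> Iz; have [a [b zE]] := basis_span z; apply: contrapT => z0.
  apply: none; exists `|nrm a b|%N; apply/asboolP; exists a, b; split=> //.
    by rewrite /elt -zE.
  by apply/eqP => /nrm_eq0[a0 b0]; apply: z0; rewrite zE a0 b0 mul0r addr0.
case: (ex_minnP exN) => n /asboolP[a [b [Iab n0 <-]]] minab.
exists a, b; split=> //; apply/seteqP; split=> [z Iz|_ [z _ <-]]; last first.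
  by rewrite mulrC; apply: mulI.
have [u [v zE]] := basis_span z; rewrite zE -/(elt u v) in Iz *.
have [x [y lt_nrm]] := nrm_euclid u v n0.
apply/mem_princ; exists x, y.
have Irem : I (elt (u - (a * x + 3 * b * y)) (v - (b * x + a * y))).
  by rewrite -eltB -eltM; apply: is_idealB => //; rewrite mulrC; apply: mulI.
have [/nrm_eq0[/subr0_eq ? /subr0_eq ?] //|rem0] :=
  eqVneq (nrm (u - (a * x + 3 * b * y)) (v - (b * x + a * y))) 0.
have := minab `|nrm (u - (a * x + 3 * b * y)) (v - (b * x + a * y))|%N.
rewrite leqNgt => /(_ _)/negP H; exfalso; apply: H; last first.
  by rewrite -ltz_nat !abszE.
by apply/asboolP; do 2 eexists; split; [exact: Irem | |].
Qed.


(** An ideal with Hermite basis (e, 0), (u0, d) has the elements i + j w with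
    0 <= i < e and 0 <= j < d as coset representatives; they are numbered
    by k = i + j e. *)
Lemma ideal_norm_hermite (I : set O) (d e : nat) (u0 : int) :
  is_ideal I -> (0 < d)%N -> (0 < e)%N -> I (elt e 0) -> I (elt u0 d) ->
  (forall u v, I (elt u v) -> (d %| v)%Z) -> (forall u, I (elt u 0) -> (e %| u)%Z) ->
  ideal_norm I = (d * e)%N.
Proof.
move=> idI d0 e0 Ie Id dvd_d dvd_e; case: (idI) => _ addI mulI.
pose rep (k : nat) := elt (k %% e)%N (k %/ e)%N.
rewrite /ideal_norm; apply: card_fset_set.
have -> : cosets I = (fun k => [set rep k + y | y in I]) @` `I_(d * e).
  apply/seteqP; split=> [_ [z _ <-]|_ [k _ <-]]; last by exists (rep k).
  have [u [v zE]] := basis_span z; rewrite -/(elt u v) in zE.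
  pose m := (v %/ d)%Z; pose u1 := u - m * u0.
  have dZ : (d : int) != 0 by lia.
  have eZ : (e : int) != 0 by lia.
  have vE := divz_eq v d; have uE := divz_eq u1 e.
  have r1 : (0 <= v %% d < d)%Z by rewrite modz_ge0 // ltz_pmod //; lia.
  have r2 : (0 <= u1 %% e < e)%Z by rewrite modz_ge0 // ltz_pmod //; lia.
  exists (`|(v %% d)%Z| * e + `|(u1 %% e)%Z|)%N => /=.
    have : (`|(v %% d)%Z| < d)%N by lia.
    have : (`|(u1 %% e)%Z| < e)%N by lia.
    nia.
  apply/coset_eqP => //; rewrite zE /rep divnMDl // modnMDl.
  rewrite divn_small; last by lia.
  rewrite modn_small; last by lia.
  rewrite addn0 eltB !gez0_abs; [|lia..].
  have -> : elt ((u1 %% e)%Z - u) ((v %% d)%Z - v)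
     = - (elt m 0 * elt u0 d + elt (u1 %/ e)%Z 0 * elt e 0).
    rewrite !eltM.
    have -> : (u1 %% e)%Z = u - m * u0 - (u1 %/ e)%Z * e by rewrite -/u1; lia.
    have -> : (v %% d)%Z = v - m * d by rewrite /m; lia.
    by rewrite /elt !(rmorphD, rmorphB, rmorphM, rmorph0) /=; ring.
  by rewrite -mulN1r; apply: (mulI); apply: addI; apply: mulI.
apply: inj_card_eq => j k /set_mem jn /set_mem kn /coset_eqP -/(_ idI).
rewrite /= in jn kn; rewrite /rep eltB.
have [jd kd] : (j %/ e < d)%N /\ (k %/ e < d)%N by rewrite !ltn_divLR.
have [jm km] : (j %% e < e)%N /\ (k %% e < e)%N by rewrite !ltn_mod.
move=> Ijk; have := dvd_d _ _ Ijk => /dvdzP[x xE].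
have jk : (j %/ e = k %/ e)%N.
  have : x = 0 by nia.
  by move=> x0; move: xE; rewrite x0 mul0r; lia.
move: Ijk; rewrite jk subrr => /dvd_e/dvdzP[y yE].
have jk2 : (j %% e = k %% e)%N.
  have : y = 0 by nia.
  by move=> y0; move: yE; rewrite y0 mul0r; lia.
by rewrite (divn_eq j e) (divn_eq k e) jk jk2.
Qed.

(** The lattice generated by a + b w and (a + b w) w = 3b + a w has determinant
    a^2 - 3b^2. With d = gcd(a, b), its second coordinates form d Z, and its
    elements of second coordinate 0 are the multiples of (a^2 - 3b^2) / d,
    which gives a Hermite basis. *)
Lemma ideal_norm_princ a b : nrm a b != 0 -> ideal_norm (princ a b) = `|nrm a b|%N.
Proof.
move=> n0; pose d := gcdn `|a| `|b|.
have [p [q pqE]] := Bezoutz a b.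
have d0 : (0 < d)%N.
  rewrite gcdn_gt0; apply: contra_neqT n0; rewrite negb_or -!eqn0Ngt !absz_eq0.
  by move=> /andP[/eqP-> /eqP->].
have /dvdzP[a' aE] : (gcdz a b %| a)%Z := dvdz_gcdl a b.
have /dvdzP[b' bE] : (gcdz a b %| b)%Z := dvdz_gcdr a b.
have dE : gcdz a b = d by [].
rewrite dE in aE bE pqE.
have copr : p * a' + q * b' = 1.
  have dZ : (d : int) != 0 by lia.
  by apply: (mulIf dZ); rewrite mul1r -[RHS]pqE [in RHS]aE [in RHS]bE; ring.
have N'0 : nrm a' b' != 0.
  apply: contra_neq n0 => N'0; transitivity (nrm a' b' * d%:Z ^+ 2).
    by rewrite /nrm aE bE; ring.
  by rewrite N'0 mul0r.
pose e := (d * `|nrm a' b'|)%N.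
have -> : `|nrm a b|%N = (d * e)%N.
  have -> : nrm a b = d%:Z * (d%:Z * nrm a' b').
    by rewrite /nrm aE bE; ring.
  by rewrite !abszM !absz_nat.
have e_mul u : (e %| u)%Z <-> exists k, u = d%:Z * nrm a' b' * k.
  rewrite /e; split=> [/dvdzP[k ->]|[k ->]].
    exists (k * Num.sg (nrm a' b')).
    by rewrite PoszM abszE normrEsg; ring.
  by apply: dvdz_mulr; rewrite dvdzE abszM absz_nat.
apply: (@ideal_norm_hermite _ _ _ (a * q + 3 * b * p)) => //.
- exact: princ_is_ideal.
- by rewrite muln_gt0 d0 absz_gt0.
- have [k kE] := (e_mul e).1 (dvdzz _).
  by apply/mem_princ; exists (a' * k), (- b' * k); rewrite kE aE bE /nrm; split; ring.
- by apply/mem_princ; exists q, p; split=> //; rewrite -pqE; ring.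
- move=> u v /mem_princ[x [y [_ ->]]]; apply/dvdzP; exists (b' * x + a' * y).
  by rewrite aE bE; ring.
move=> u /mem_princ[x [y [-> /esym H]]]; apply/e_mul.
have {}H : b' * x + a' * y = 0.
  have dZ : (d : int) != 0 by lia.
  by apply: (mulIf dZ); rewrite mul0r -H aE bE; ring.
exists (p * x - q * y).
have xE : x = a' * (p * x - q * y).
  have -> : a' * (p * x - q * y) = (p * a' + q * b') * x - q * (b' * x + a' * y) by ring.
  by rewrite copr H; ring.
have yE : y = - b' * (p * x - q * y).
  have -> : - b' * (p * x - q * y) = (p * a' + q * b') * y - p * (b' * x + a' * y) by ring.
  by rewrite copr H; ring.
by move: (p * x - q * y) xE yE => k -> ->; rewrite /nrm aE bE; ring.
Qed.

(** * A fundamental domain for the units *)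

Lemma princ_unit a b c d : nrm c d = 1 ->
  princ (a * c + 3 * b * d) (b * c + a * d) = princ a b.
Proof.
move=> cd1; apply/seteqP; split=> _ [z _ <-].
  by exists (elt c d * z) => //; rewrite mulrA eltM.
(* c - d w is the inverse of c + d w *)
exists (elt c (- d) * z) => //; rewrite mulrA eltM.
congr (elt _ _ * z).
  by transitivity (a * nrm c d); [rewrite /nrm; ring | rewrite cd1 mulr1].
by transitivity (b * nrm c d); [rewrite /nrm; ring | rewrite cd1 mulr1].
Qed.

Definition fund_domain (m : nat) : set (int * int) :=
  [set p | [/\ 0 < p.1, - p.1 < 3 * p.2, 3 * p.2 < p.1 & nrm p.1 p.2 = m]].

(** Squares are 0 or 1 mod 3. *)
Lemma nrm_mod3 a b : exists k, nrm a b = 3 * k \/ nrm a b = 3 * k + 1.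
Proof.
have := divz_eq a 3; set x := (a %/ 3)%Z; set e := (a %% 3)%Z => aE.
exists (3 * x ^+ 2 + 2 * x * e + (e == 2) - b ^+ 2).
have [e0|[e1|e2]] : e = 0 \/ (e = 1 \/ e = 2) by lia.
- by left; rewrite /nrm aE e0 /=; ring.
- by right; rewrite /nrm aE e1 /=; ring.
- by right; rewrite /nrm aE e2 /=; ring.
Qed.

(** If c + d w = (a + b w) (x + y w), then m y = a d - b c, where m is the norm.
    In the cone, a^2 < 3m/2 and b^2 < m/6, and likewise for c and d, so |a d|
    and |b c| are both less than m/2. Hence y = 0, and x = 1. *)
Lemma fund_domain_inj m a b c d : (0 < m)%N ->
  fund_domain m (a, b) -> fund_domain m (c, d) -> princ a b = princ c d ->
  a = c /\ b = d.
Proof.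
rewrite /nrm => m0 [/= a0 b1 b2 nab] [/= c0 d1 d2 ncd] E.
have /mem_princ[x [y [cE dE]]] : princ a b (elt c d).
  by rewrite E; exists 1; rewrite ?mulr1.
have nxy : nrm x y = 1.
  have m0' : (m%:Z : int) != 0 by lia.
  by apply: (mulfI m0'); rewrite mulr1 -{1}nab -nrmM -cE -dE.
have yE : m%:Z * y = a * d - b * c by rewrite -nab cE dE /nrm; ring.
have y0 : y = 0.
  have ub (u v : int) : 0 < u -> - u < 3 * v -> 3 * v < u -> nrm u v = m%:Z ->
      2 * u ^+ 2 < 3 * m%:Z /\ 6 * v ^+ 2 < m%:Z.
    rewrite /nrm => u0 v1 v2 mE; have : 0 < (u - 3 * v) * (u + 3 * v) by apply: mulr_gt0; lia.
    have -> : (u - 3 * v) * (u + 3 * v) = u ^+ 2 - 9 * v ^+ 2 by ring.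
    by move: (u ^+ 2) (v ^+ 2) mE => X Y mE H; split; lia.
  have [ua vb] := ub _ _ a0 b1 b2 nab; have [uc vd] := ub _ _ c0 d1 d2 ncd.
  have half u v : 2 * u ^+ 2 < 3 * m%:Z -> 6 * v ^+ 2 < m%:Z -> - m%:Z < 2 * (u * v) < m%:Z.
    move=> Hu Hv; rewrite -ltr_norml -(ltr_pXn2r (n := 2)) ?nnegrE //.
    rewrite -normrX ger0_norm ?sqr_ge0 //.
    have : (2 * u ^+ 2) * (6 * v ^+ 2) < (3 * m%:Z) * m%:Z.
      by apply: ltr_pM => //; rewrite mulr_ge0 // sqr_ge0.
    have -> : (2 * u ^+ 2) * (6 * v ^+ 2) = 3 * (2 * (u * v)) ^+ 2 by ring.
    have -> : (3 * m%:Z) * m%:Z = 3 * m%:Z ^+ 2 by ring.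
    by lia.
  have := half _ _ ua vd; have := half _ _ uc vb.
  rewrite (mulrC c); move: yE; set p := a * d; set r := b * c => yE H1 H2.
  by nia.
move: nxy cE dE; rewrite y0 /nrm => nxy cE dE.
have : x = 1 by nia.
by move=> x1; rewrite cE dE x1; split; ring.
Qed.

(** Among the generators of norm m take one, c + d w, with |c| least. After a
    change of sign c > 0; comparing with the products by the units 2 + w and
    2 - w gives c <= |2c + 3d| and c <= |2c - 3d|, where 2c + 3d and 2c - 3d
    are positive since c^2 > 3 d^2. So |3d| <= c, and equality would make
    m = 6 d^2 divisible by 3. *)
Lemma fund_domain_surj (m : nat) a b : nrm a b = m%:Z -> m = 1 %[mod 3] ->
  exists2 p, fund_domain m p & princ p.1 p.2 = princ a b.
Proof.
move=> nab m1.
pose size_of n := `[< exists c d, [/\ princ c d = princ a b, nrm c d = m & `|c|%N = n] >].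
have exN : exists n, size_of n by exists `|a|%N; apply/asboolP; exists a, b.
case: (ex_minnP exN) => n /asboolP[c [d [E ncd <-]]] minc.
have {}minc x y : nrm x y = 1 -> `|c| <= `|c * x + 3 * d * y|.
  move=> nxy; rewrite -!abszE lez_nat; apply: minc; apply/asboolP.
  by do 2 eexists; split; [rewrite -E; exact: princ_unit nxy | rewrite nrmM nxy mulr1 | ].
wlog c0 : c d E ncd minc / 0 < c.
  move=> H; have [c0|c0] := ltrP 0 c; first exact: (H c d).
  apply: (H (- c) (- d)).
  - by rewrite -E -(@princ_unit c d (-1) 0) //; congr princ; ring.
  - by rewrite -ncd /nrm; ring.
  - move=> x y /minc; rewrite normrN.
    have -> : - c * x + 3 * - d * y = - (c * x + 3 * d * y) by ring.
    by rewrite normrN.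
  - rewrite oppr_gt0 lt_neqAle c0 andbT; apply/eqP => c00.
    move: ncd; rewrite /nrm c00 expr0n; have := sqr_ge0 d; move: (d ^+ 2); lia.
have pos x : nrm c x = m -> 0 < c * 2 + 3 * x.
  move=> ncx; rewrite ltNge; apply/negP => le0.
  have : (2 * c) * (2 * c) <= (- 3 * x) * (- 3 * x) by apply: ler_pM; lia.
  have -> : (2 * c) * (2 * c) = 4 * m%:Z + 12 * x ^+ 2 by rewrite -ncx /nrm; ring.
  have -> : (- 3 * x) * (- 3 * x) = 9 * x ^+ 2 by ring.
  by have := sqr_ge0 x; move: (x ^+ 2); lia.
have off x : nrm c x = m -> c <> 3 * x.
  move=> + cE; rewrite /nrm cE => ncx.
  have : m%:Z = 3 * (2 * x ^+ 2) by rewrite -ncx; ring.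
  by move: (x ^+ 2); lia.
have ncNd : nrm c (- d) = m by rewrite -ncd /nrm sqrrN.
exists (c, d) => //; split=> //=.
- by have := minc 2 1 erefl; have := pos _ ncd; have := off _ ncNd; lia.
- by have := minc 2 (-1) erefl; have := pos _ ncNd; have := off _ ncd; lia.
Qed.

Lemma fund_domain_bij (m : nat) : m = 1 %[mod 3] ->
  set_bij (fund_domain m)
    [set I : set O | [/\ is_ideal I, I <> [set 0] & ideal_norm I = m]]
    (fun p => princ p.1 p.2).
Proof.
move=> m1; have m0 : (0 < m)%N by lia.
split.
- move=> [a b] [/= _ _ _ nab]; have n0 : nrm a b != 0 by rewrite nab; lia.
  split; [exact: princ_is_ideal | | by rewrite ideal_norm_princ // nab].
  move=> E0; have : princ a b (elt a b) by exists 1; rewrite ?mulr1.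
  by rewrite E0 => /elt_eq0[a0 b0]; move: n0; rewrite a0 b0.
- move=> [a b] [c d] /set_mem Dp /set_mem Dq /(fund_domain_inj m0 Dp Dq) [-> ->] //.
move=> I [idI I0 nI]; have [a [b [n0 IE]]] := ideal_princ idI I0.
have nab : nrm a b = m.
  move: nI; rewrite IE ideal_norm_princ // => nI.
  by have [k] := nrm_mod3 a b; lia.
have [p Dp pE] := fund_domain_surj nab m1.
by exists p => //; rewrite pE -IE.
Qed.

End SqrtThree.

(** * Comparison of the two counts *)

Definition index_point k (t : 'I_k.+1 * 'I_(2 * k).+1 * bool) : int * int :=
  ((3 * t.1.1 + 1 + t.2)%N%:Z, t.1.2%:Z - t.1.1%:Z).

(** Completing the square: 3 f7_exponent r i e + 1 = x^2 - 3 y^2 for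
    x = 3r + 1 + e and y = i - r, and every x > 0 prime to 3 is of this form. *)
Lemma index_point_bij k :
  set_bij [set` f7_index k] (fund_domain (3 * k + 1)) (@index_point k).
Proof.
have nrmE (r i : nat) (e : bool) : (i <= 2 * r)%N ->
    nrm (3 * r + 1 + e)%N%:Z (i%:Z - r%:Z) = (3 * f7_exponent r i e + 1)%N%:Z.
  move=> /subnKC; set j := (_ - _)%N => ij; rewrite /f7_exponent /nrm.
  rewrite -/j; have -> : (2 * r)%N = (i + j)%N by [].
  have rE : r%:Z * 2 = i%:Z + j%:Z by lia.
  by case: e; nia.
split.
- move=> [[r i] e] /andP[/= ir /eqP ek]; rewrite /fund_domain /index_point /=.
  split; [lia | case: (e); lia | case: (e); lia | by rewrite nrmE // ek].
- move=> [[r i] e] [[r' i'] e'] /set_mem/andP[/= ir _] /set_mem/andP[/= ir' _] [].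
  rewrite /index_point /= => H1 H2.
  have /val_inj rr : r = r' :> nat by move: H1; case: (e); case: (e'); lia.
  have /val_inj ii : i = i' :> nat by rewrite rr in H2; lia.
  by move: H1; rewrite rr ii; case: (e); case: (e') => //; lia.
move=> [x y] [/= x0 y1 y2 xyk].
have x3 z : x <> 3 * z.
  move=> xE; have : 3 * (3 * z ^+ 2 - y ^+ 2) = (3 * k + 1)%N%:Z.
    by rewrite -xyk xE /nrm; ring.
  by move: (3 * z ^+ 2 - y ^+ 2); lia.
have [r [e xE]] : exists (r : nat) (e : bool), x = (3 * r + 1 + e)%N%:Z.
  exists (`|x| %/ 3)%N, (`|x| %% 3 == 2)%N.
  by have := x3 (`|x| %/ 3)%N; case: eqP; lia.
pose i := absz (y + r%:Z).
have iE : i%:Z = y + r%:Z by rewrite /i; case: (e) xE; lia.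
have ir : (i <= 2 * r)%N by case: (e) xE; lia.
have yE : y = i%:Z - r%:Z by lia.
have ek : f7_exponent r i e = k.
  by move: xyk; rewrite xE yE nrmE // => -[]; lia.
have rk : (r < k.+1)%N by move: ek; rewrite /f7_exponent; nia.
have ik : (i < (2 * k).+1)%N by lia.
exists (Ordinal rk, Ordinal ik, e); first by apply/andP; split=> //=; apply/eqP.
by rewrite /index_point /= xE yE.
Qed.

Section RingOfIntegersSqrt3.
Variables (L : fieldExtType rat) (s : L).
Hypotheses (hs : s ^+ 2 = 3) (hL : <<1%VS; s>>%VS = fullv).

Lemma sqrt3_algint : s \in @algint L.
Proof.
apply/asboolP; exists ('X^2 - 3%:P); first exact: monicXnsubC.
by rewrite rmorphB /= map_polyXn map_polyC /root hornerD hornerN hornerXn hornerC hs subrr.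
Qed.

Let w : intring L := IntRing sqrt3_algint.

Lemma intring_sqr : w ^+ 2 = 3.
Proof. by apply: val_inj; rewrite rmorphXn rmorph_nat. Qed.

Lemma intring_span (z : intring L) : exists a b : int, z = a%:~R + b%:~R * w.
Proof.
have [a [b zE]] := quad_span hs hL (val z).
have : a%:A + b *: s \in @algint L by rewrite -zE; exact: valP.
move=> /(quad_integer hs)[m [n [aE bE]]]; exists m, n.
apply: val_inj; rewrite zE rmorphD rmorphM !rmorph_int /= aE bE.
by rewrite scaler_int -[n%:~R *: s]mulr_algl scaler_int.
Qed.

Lemma intring_free (a b : int) : a%:~R + b%:~R * w = 0 -> a = 0 /\ b = 0.
Proof.
move=> /(congr1 val); rewrite rmorphD rmorphM !rmorph_int rmorph0 /= => H.
have [] := @quad_free L s hs a%:~R b%:~R.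
  by rewrite scaler_int -[b%:~R *: s]mulr_algl scaler_int.
by move=> /eqP + /eqP; rewrite !intr_eq0 => /eqP-> /eqP->.
Qed.

Lemma ideal_bij k : set_bij [set` f7_index k]
  [set I : set (intring L) |
    [/\ is_ideal I, I <> [set 0] & ideal_norm I = (3 * k + 1)%N]]
  (fun t => princ w (index_point t).1 (index_point t).2).
Proof.
have m1 : (3 * k + 1 = 1 %[mod 3])%N by lia.
have H := fund_domain_bij intring_sqr intring_span intring_free m1.
exact: (set_bij_comp (@index_point_bij k) H).
Qed.

End RingOfIntegersSqrt3.

Theorem theorem1p7 (L : fieldExtType rat) (s : L)
    (hs : s ^+ 2 = 3) (hL : <<1%VS; s>>%VS = fullv) :
  let ideals := [set I : set (intring L) |
    [/\ is_ideal I, I <> [set 0] & ideal_norm I = 1 %[mod 3]]] in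
  let term (I : set (intring L)) : fps int :=
    (-1) ^+ ideal_norm I * 'q ^+ ideal_norm I in
  [/\ fps_summable [set: nat] f7_term,
      fps_summable ideals term &
      'q * fps_comp f7 ('q ^+ 3) = - fps_sum ideals term].
Proof.
move=> ideals term.
have term_coef I n : fps_coef (term I) n = if ideal_norm I == n then (-1) ^+ n else 0.
  rewrite /term fps_coef_signM fps_coefXn eq_sym.
  by case: eqP => [->|_]; rewrite ?mulr1 ?mulr0.
split; first exact: f7_summable.
- move=> n.
  have [n1|n1] := eqVneq (n %% 3)%N 1%N; last first.
    apply: (@sub_finite_set _ _ set0); last exact: finite_set0.
    move=> I [[_ _ I1]].
    rewrite term_coef; case: ifP => [/eqP In _|_]; last by rewrite eqxx.
    by move: n1; rewrite -In I1.
  have nE : n = (3 * (n %/ 3) + 1)%N by lia.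
  have [_ _ surj] := ideal_bij hs hL (n %/ 3).
  apply: sub_finite_set (finite_image _ (@finite_finpred _ _ (f7_index (n %/ 3)))).
  move=> I [[idI I0 _]]; rewrite term_coef.
  case: ifP => [/eqP In _|_]; last by rewrite eqxx.
  by apply: surj; split=> //; rewrite In.
apply: fpsP => n; rewrite fps_coefXM fps_coefN fps_coef_fsum.
under eq_fsbigr do rewrite term_coef.
have [n1|n1] := eqVneq (n %% 3)%N 1%N; last first.
  rewrite fsbig1 ?oppr0 => [|I [_ _ I1]]; last first.
    by case: eqP => // In; move: n1; rewrite -In I1.
  case: n n1 => // n n1; rewrite fps_comp_Xn // ifF //.
  by apply: contraNF n1 => /dvdnP[m ->]; lia.
set k := (n %/ 3)%N; have nE : n = (3 * k + 1)%N by rewrite /k; lia.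
rewrite nE addn1 fps_comp_Xn // dvdn_mulr // mulKn // f7_coef.
rewrite -(fsbig_widen [set I : set (intring L) |
    [/\ is_ideal I, I <> [set 0] & ideal_norm I = (3 * k + 1)%N]] ideals).
- rewrite (reindex_fsbig _ _ _ _ (ideal_bij hs hL k)).
  rewrite (eq_fsbigr (fun=> - (-1) ^+ k)) => [|t /set_mem Pt]; last first.
    have [homo _ _] := ideal_bij hs hL k; have [_ _ ->] := homo t Pt.
    by rewrite addn1 eqxx exprS exprM mulN1r (_ : (-1) ^+ 3 = -1).
  rewrite -(bigfs _ (index_enum_uniq _)) => [|t _]; last by rewrite mem_index_enum.
  by rewrite sumrN opprK.
- by move=> I [idI I0 In]; split=> //; rewrite In; lia.
move=> I [[idI I0 _] nI] /=; case: eqP => // In; case: nI; split=> //.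
by rewrite In addn1.
Qed.
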